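(* Let $p\ge 1$, let $\Sigma\in\mathbb{R}^{p\times p}$ be symmetric positive definite, and let $w=w(\Sigma)$ be its global minimum-variance portfolio. For a symmetric $E\in\mathbb{R}^{p\times p}$ let $\mathrm{d}w(E)=-(I-w\mathbf{1}^{\top})\Sigma^{-1}E\,w$, and let $P_1=I-\tfrac1p\mathbf{1}\mathbf{1}^{\top}$ be the orthogonal projector onto $\mathbf{1}^{\perp}$. Then: (i) (Factorisation.) $\mathrm{d}w(E)$ depends on $E$ only through the vector $Ew$: if $E_1w=E_2w$ then $\mathrm{d}w(E_1)=\mathrm{d}w(E_2)$. (ii) (Blind subspace.) $\mathrm{d}w(E)=0$ if and only if $Ew\parallel\mathbf{1}$ (equivalently, $Ew\parallel\Sigma w$). The set of vectors $v=Ew$ satisfying this condition is a linear subspace of codimension $p-1$ in $\mathbb{R}^p$ (the space of vectors $Ew$). Regret is invariant to such errors: if $Ew\parallel\mathbf{1}$ and $\Sigma+E$ is positive definite, then $\mathcal{R}(\Sigma+E)=\mathcal{R}(\Sigma)=0$. (iii) (Effective rank.) The linear map $\mathbb{R}^p\to\mathbb{R}^p$, $v\mapsto -(I-w\mathbf{1}^{\top})\Sigma^{-1}v$ (which sends $Ew$ to $\mathrm{d}w(E)$), has rank exactly $p-1$, and it factors through $P_1v$: its value is unchanged if $v$ is replaced by $P_1v+c\mathbf{1}$, for any $c\in\mathbb{R}$. (iv) (Scale invariance.) For every scalar $c$, the error $E=c\Sigma$ gives $\mathrm{d}w(E)=0$; moreover $\mathcal{R}(\Sigma+c\Sigma)=0$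 exactly whenever $\Sigma+c\Sigma$ is positive definite (i.e. $c>-1$).
   Context: $\mathbf{1}\in\mathbb{R}^p$ is the all-ones vector and $I$ the $p\times p$ identity. For a symmetric positive definite $S\in\mathbb{R}^{p\times p}$, the global minimum-variance portfolio (GMVP) of $S$ is $$w(S)=\arg\min_{x\in\mathbb{R}^p:\ \mathbf{1}^{\top}x=1} x^{\top}Sx=\frac{S^{-1}\mathbf{1}}{\mathbf{1}^{\top}S^{-1}\mathbf{1}}.$$ For a symmetric positive definite $\widehat{\Sigma}$, the regret of $\widehat{\Sigma}$ relative to the true covariance $\Sigma$ is $\mathcal{R}(\widehat{\Sigma})=w(\widehat{\Sigma})^{\top}\Sigma\,w(\widehat{\Sigma})-w(\Sigma)^{\top}\Sigma\,w(\Sigma)$. For a vector $v$ and a nonzero vector $u$, $v\parallel u$ means that $v$ is a scalar multiple of $u$ (the zero vector allowed). The vector $\mathrm{d}w(E)$ is the first-order (directional-derivative) displacement of the GMVP weights when $\Sigma$ is perturbed to $\Sigma+E$. *)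

(* Defs.v *)
From HB Require Import structures.
From mathcomp Require Import all_boot all_order all_algebra.
From mathcomp Require Import boolp classical_sets reals.

Set Implicit Arguments.
Unset Strict Implicit.
Unset Printing Implicit Defensive.

Import Order.TTheory GRing.Theory Num.Theory.

Local Open Scope ring_scope.

Definition ones {R : realType} {p : nat} : 'cV[R]_p := const_mx 1.

Definition dotv (R : realType) (p : nat) (x y : 'cV[R]_p) : R :=
  (x^T *m y) 0 0.

Definition symmx (R : realType) (p : nat) (S : 'M[R]_p) : Prop := S^T = S.

Definition spd (R : realType) (p : nat) (S : 'M[R]_p) : Prop :=
  symmx S /\ forall x : 'cV[R]_p, x != 0 -> 0 < dotv x (S *m x).

Definition is_gmvp (R : realType) (p : nat) (S : 'M[R]_p) (x : 'cV[R]_p) : Prop :=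
  dotv ones x = 1 /\
  forall y : 'cV[R]_p, dotv ones y = 1 -> dotv x (S *m x) <= dotv y (S *m y).

(* The argmin, with value 0 when there is no minimiser; for p >= 1 and S
   positive definite the minimiser exists and is unique, see [gmvpE]. *)
Definition gmvp (R : realType) (p : nat) (S : 'M[R]_p) : 'cV[R]_p :=
  xget 0 (is_gmvp S).

Definition regret (R : realType) (p : nat) (Sigma Shat : 'M[R]_p) : R :=
  dotv (gmvp Shat) (Sigma *m gmvp Shat)
  - dotv (gmvp Sigma) (Sigma *m gmvp Sigma).

(* Only used for nonzero [u]; [v = 0] is allowed. *)
Definition parallel (R : realType) (p : nat) (v u : 'cV[R]_p) : Prop :=
  exists c : R, v = c *: u.

(* The derivative of [gmvp] at Sigma in direction E, given in closed form. *)
Definition dgmvp (R : realType) (p : nat) (Sigma E : 'M[R]_p) : 'cV[R]_p :=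
  - ((1%:M - gmvp Sigma *m ones^T) *m invmx Sigma *m E *m gmvp Sigma).

Definition dgmvp_map (R : realType) (p : nat) (Sigma : 'M[R]_p)
    (v : 'cV[R]_p) : 'cV[R]_p :=
  - ((1%:M - gmvp Sigma *m ones^T) *m invmx Sigma *m v).

Definition P1 (R : realType) (p : nat) : 'M[R]_p :=
  1%:M - p%:R^-1 *: (ones *m ones^T).

Definition codimv (K : fieldType) (vT : vectType K) (V : {vspace vT}) : nat :=
  (\dim {:vT} - \dim V)%N.

Section ClosedForm.
Variables (R : realType) (p : nat).
Implicit Types (S : 'M[R]_p) (x y z : 'cV[R]_p).

Lemma dotvC x y : dotv x y = dotv y x.
Proof. by rewrite /dotv -[y^T *m x]trmxK trmx_mul trmxK [RHS]mxE. Qed.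

Lemma dotvDr x y z : dotv x (y + z) = dotv x y + dotv x z.
Proof. by rewrite /dotv mulmxDr mxE. Qed.

Lemma dotvZr (a : R) x y : dotv x (a *: y) = a * dotv x y.
Proof. by rewrite /dotv -scalemxAr mxE. Qed.

Lemma dotv_sym S x y : symmx S -> dotv x (S *m y) = dotv y (S *m x).
Proof. by move=> Ss; rewrite dotvC /dotv trmx_mul Ss mulmxA. Qed.

Lemma spd_unitmx S : spd S -> S \in unitmx.
Proof.
case=> Ss Sp; rewrite -row_free_unit -kermx_eq0; apply/eqP/row_matrixP => i.
rewrite row0; apply/eqP; apply: contraT => ri0.
have /Sp : (row i (kermx S))^T != 0 by rewrite trmx_eq0.
by rewrite -{2}Ss -trmx_mul -row_mul mulmx_ker row0 trmx0 /dotv mulmx0 mxE ltxx.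
Qed.

Lemma gmvpE S : (1 <= p)%N -> spd S ->
  gmvp S = (dotv ones (invmx S *m ones))^-1 *: (invmx S *m ones) /\
  (forall x, is_gmvp S x <-> x = gmvp S).
Proof.
move=> p1 Sspd; have Su := spd_unitmx Sspd; have [Ss Sp] := Sspd.
set u := invmx S *m ones; set s := dotv _ u; set w0 := _ *: u.
have Su1 : S *m u = ones by rewrite mulKVmx.
have u0 : u != 0.
  apply: contraTneq p1 => u0; rewrite -leqNgt leqn0; apply/eqP.
  case: p S u Su1 u0 {Sspd Su Ss Sp s w0} => // n S u Su1 u0.
  move: Su1; rewrite u0 mulmx0 => /matrixP /(_ 0 0) /eqP.
  by rewrite !mxE eq_sym oner_eq0.
have s0 : 0 < s by rewrite /s dotvC -Su1 Sp.
have w1 : dotv ones w0 = 1 by rewrite dotvZr mulVf ?gt_eqF.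
have quad y : dotv ones y = 1 ->
    dotv y (S *m y) = dotv w0 (S *m w0) + dotv (y - w0) (S *m (y - w0)).
  move=> y1; have Sw : S *m w0 = s^-1 *: ones by rewrite -scalemxAr Su1.
  have d1 : dotv (y - w0) (S *m w0) = 0.
    rewrite Sw dotvZr dotvC dotvDr -scaleN1r dotvZr w1 y1.
    by rewrite mulN1r subrr mulr0.
  rewrite -[in LHS](subrK w0 y); move: (y - w0) d1 => d d1.
  rewrite mulmxDr dotvDr !(dotvC (d + w0)) !dotvDr.
  rewrite !(dotvC (S *m _)).
  by rewrite (dotv_sym w0 d Ss) d1 addr0 add0r addrC.
have dge y : 0 <= dotv y (S *m y).
  have [->|/Sp/ltW//] := eqVneq y 0.
  by rewrite mulmx0 /dotv mulmx0 mxE.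
have w0P : is_gmvp S w0 by split=> // y /quad ->; rewrite lerDl.
have w0U y : is_gmvp S y -> y = w0.
  case=> y1 /(_ _ w1); rewrite (quad _ y1) gerDl => le0.
  apply/eqP; rewrite -subr_eq0; apply: contraTT le0 => /Sp.
  by rewrite -ltNge.
have -> : gmvp S = w0 by apply: xget_unique.
by split=> // x; split=> [/w0U//|->].
Qed.

End ClosedForm.

(* Main.v *)
(* Since Sigma w is a nonzero multiple of 1 and 1^T w = 1, the map
   v |-> -(I - w 1^T) Sigma^-1 v kills v exactly when v is a multiple of
   Sigma w, i.e. of 1; its kernel is thus the line spanned by 1.  If E w is a
   multiple of 1, then so is (Sigma + E) w, and w satisfies the first-order
   condition characterising the minimum-variance portfolio of Sigma + E. *)
Require Import Defs.
From HB Require Import structures.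
From mathcomp Require Import all_boot all_order all_algebra.
From mathcomp Require Import boolp classical_sets reals.

Import Order.TTheory GRing.Theory Num.Theory.

Local Open Scope ring_scope.

Section Gmvp.
Set Implicit Arguments.
Unset Strict Implicit.
Variables (R : realType) (p : nat).
Hypothesis hp : (1 <= p)%N.
Implicit Types (S E : 'M[R]_p) (x v : 'cV[R]_p).

Lemma mulmx_cV_dotv x y v : x *m (y^T *m v) = dotv y v *: x.
Proof. by rewrite [y^T *m v]mx11_scalar mul_mx_scalar. Qed.

Lemma ones_neq0 : @ones R p != 0.
Proof.
apply/eqP => /matrixP /(_ (Ordinal hp) 0) /eqP.
by rewrite !mxE oner_eq0.
Qed.

Lemma dotv_ones_gmvp S : spd S -> dotv ones (gmvp S) = 1.
Proof. by move=> /(gmvpE hp)[_ /(_ (gmvp S))[_ /(_ erefl)[]]]. Qed.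

Lemma gmvp_neq0 S : spd S -> gmvp S != 0.
Proof.
move=> /dotv_ones_gmvp; apply: contra_eq_neq => ->.
by rewrite /dotv mulmx0 mxE eq_sym oner_eq0.
Qed.

(** The closed form gives [a] as the inverse of 1^T S^-1 1. It is nonzero because [a = 0] would
    force w = 0, against 1^T w = 1; this permits division by [a] when directions are compared. *)
Lemma mulmx_gmvp S : spd S -> exists2 a, a != 0 & S *m gmvp S = a *: ones.
Proof.
move=> Sspd; have [gE _] := gmvpE hp Sspd.
exists (dotv ones (invmx S *m ones))^-1; last first.
  by rewrite gE -scalemxAr mulKVmx // spd_unitmx.
by apply: contra_neq (gmvp_neq0 Sspd) => a0; rewrite gE a0 scale0r.
Qed.

(* First-order condition: Sx is a multiple of the constraint gradient. *)
Lemma gmvp_unique S x a : spd S ->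
  dotv ones x = 1 -> S *m x = a *: ones -> gmvp S = x.
Proof.
move=> Sspd x1 Sx; have [gE _] := gmvpE hp Sspd.
have xE : x = a *: (invmx S *m ones).
  by rewrite scalemxAr -Sx mulKmx // spd_unitmx.
(* The constraint reads a (1^T S^-1 1) = 1, so [a] is exactly the normalising factor of the closed
   form. *)
move: x1; rewrite gE {1}xE dotvZr mulrC => /mulr1_eq ->.
by rewrite -xE.
Qed.

Lemma dgmvp_mapE S v :
  dgmvp_map S v = dotv ones (invmx S *m v) *: gmvp S - invmx S *m v.
Proof.
by rewrite /dgmvp_map -mulmxA mulmxBl mul1mx -mulmxA mulmx_cV_dotv opprB.
Qed.

Lemma dgmvpE S E : dgmvp S E = dgmvp_map S (E *m gmvp S).
Proof. by rewrite /dgmvp /dgmvp_map !mulmxA. Qed.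

Lemma parallel_ones_mulmx S v : spd S ->
  parallel v ones <-> parallel v (S *m gmvp S).
Proof.
case/mulmx_gmvp => a a0 ->; split=> -[c ->]; last by exists (c * a); rewrite scalerA.
by exists (c / a); rewrite scalerA divfK.
Qed.

Lemma dgmvp_map_eq0 S v : spd S -> dgmvp_map S v = 0 <-> parallel v ones.
Proof.
move=> Sspd; rewrite dgmvp_mapE (parallel_ones_mulmx v Sspd).
have Su := spd_unitmx Sspd; split=> [/eqP|[c ->]].
  (* Vanishing means S^-1 v = (1^T S^-1 v) w; applying S gives the multiple of S w. *)
  rewrite subr_eq0 => /eqP e; exists (dotv ones (invmx S *m v)).
  by rewrite scalemxAr e mulKVmx.
by rewrite scalemxAr mulKmx // dotvZr dotv_ones_gmvp // mulr1 subrr.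
Qed.

Lemma dgmvp_map_addZones S v c : spd S ->
  dgmvp_map S (v + c *: ones) = dgmvp_map S v.
Proof.
move=> Sspd; rewrite /dgmvp_map mulmxDr opprD -/(dgmvp_map S (c *: ones)).
have /(dgmvp_map_eq0 _ Sspd) -> : parallel (c *: @ones R p) ones by exists c.
by rewrite addr0.
Qed.

Lemma P1_mulmx v : P1 R p *m v = v - (p%:R^-1 * dotv ones v) *: ones.
Proof. by rewrite /P1 mulmxBl mul1mx -scalemxAl -mulmxA mulmx_cV_dotv scalerA. Qed.

(** Restricting to symmetric errors loses no vector E w. The term v 1^T alone sends x to v; adding
    its transpose makes the matrix symmetric, and the multiple of 1 1^T cancels the extra (v^T x)
    1. *)
Lemma symmx_mulmx_surj x v : dotv ones x = 1 ->
  exists E, symmx E /\ v = E *m x.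
Proof.
move=> x1.
exists (v *m ones^T + ones *m v^T - dotv v x *: (ones *m ones^T)); split.
  rewrite /symmx linearB linearD linearZ /= !trmx_mul !trmxK.
  by congr (_ - _); rewrite addrC.
rewrite mulmxBl mulmxDl -scalemxAl -!mulmxA !mulmx_cV_dotv x1 !scale1r.
by rewrite addrK.
Qed.

Lemma mem_line_ones v : v \in <[@ones R p]>%VS <-> parallel v ones.
Proof. by split=> [/vlineP|?]; last apply/vlineP. Qed.

Lemma dim_cV_fullv : \dim {:'cV[R]_p} = p.
Proof. by rewrite dimvf /dim /= muln1. Qed.

Lemma codimv_line_ones : codimv <[@ones R p]> = (p - 1)%N.
Proof. by rewrite /codimv dim_cV_fullv dim_vline ones_neq0. Qed.

(** Rank-nullity, the kernel being the line spanned by [ones]. *)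
Lemma dim_limg_dgmvp_map S (f : 'Hom('cV[R]_p, 'cV[R]_p)) : spd S ->
  (forall v, f v = dgmvp_map S v) -> \dim (limg f) = (p - 1)%N.
Proof.
move=> Sspd fE.
have kerE : lker f = <[ones]>%VS.
  apply/vspaceP => v; rewrite memv_ker fE; apply/eqP/idP.
    by move=> /(dgmvp_map_eq0 _ Sspd) /mem_line_ones.
  by move=> /mem_line_ones /(dgmvp_map_eq0 _ Sspd).
have := limg_ker_dim f fullv.
by rewrite capfv kerE dim_vline ones_neq0 dim_cV_fullv => e; rewrite -[in RHS]e addKn.
Qed.

Lemma gmvp_blind S E : spd S -> spd (S + E) ->
  parallel (E *m gmvp S) ones -> gmvp (S + E) = gmvp S.
Proof.
move=> Sspd SEspd [c Ew]; have [a _ Sw] := mulmx_gmvp Sspd.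
apply: (@gmvp_unique _ _ (a + c)) => //; first exact: dotv_ones_gmvp.
by rewrite mulmxDl Sw Ew scalerDl.
Qed.

Lemma regret_blind S E : spd S -> spd (S + E) ->
  parallel (E *m gmvp S) ones -> regret S (S + E) = 0.
Proof. by move=> Sspd SEspd Ew; rewrite /regret gmvp_blind // subrr. Qed.

Lemma spd_addZ S c : spd S -> spd (S + c *: S) <-> -1 < c.
Proof.
move=> Sspd; have [Ss Sp] := Sspd.
have SE : S + c *: S = (1 + c) *: S by rewrite scalerDl scale1r.
rewrite SE -[-1 < c]subr_gt0 opprK [c + 1]addrC.
(* The weights serve as a nonzero test vector: positivity of (1 + c) w^T S w forces 1 + c > 0. *)
split=> [[_ /(_ _ (gmvp_neq0 Sspd))]|c0].
  by rewrite -scalemxAl dotvZr pmulr_lgt0 // Sp // gmvp_neq0.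
split=> [|x x0]; first by rewrite /symmx linearZ /= Ss.
by rewrite -scalemxAl dotvZr mulr_gt0 // Sp.
Qed.

End Gmvp.

Theorem proposition5p1 (R : realType) (p : nat) (hp : (1 <= p)%N)
    (Sigma : 'M[R]_p) (hSigma : spd Sigma) :
  let w := gmvp Sigma in
  (* (i) *)
  (forall E1 E2 : 'M[R]_p, symmx E1 -> symmx E2 ->
     E1 *m w = E2 *m w -> dgmvp Sigma E1 = dgmvp Sigma E2) /\
  (* (ii) *)
  ((forall E : 'M[R]_p, symmx E ->
      (dgmvp Sigma E = 0 <-> parallel (E *m w) ones) /\
      (parallel (E *m w) ones <-> parallel (E *m w) (Sigma *m w))) /\
   (forall v : 'cV[R]_p, exists E : 'M[R]_p, symmx E /\ v = E *m w) /\
   (exists V : {vspace 'cV[R]_p},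
      (forall v : 'cV[R]_p,
         v \in V <->
         exists E : 'M[R]_p, symmx E /\ v = E *m w /\ parallel (E *m w) ones) /\
      codimv V = (p - 1)%N) /\
   (forall E : 'M[R]_p, symmx E ->
      parallel (E *m w) ones -> spd (Sigma + E) ->
      regret Sigma (Sigma + E) = regret Sigma Sigma /\
      regret Sigma Sigma = 0)) /\
  (* (iii) *)
  ((forall E : 'M[R]_p, symmx E ->
      dgmvp_map Sigma (E *m w) = dgmvp Sigma E) /\
   (exists f : 'Hom('cV[R]_p, 'cV[R]_p),
      (forall v : 'cV[R]_p, f v = dgmvp_map Sigma v) /\
      \dim (limg f) = (p - 1)%N) /\
   (forall (v : 'cV[R]_p) (c : R),
      dgmvp_map Sigma (P1 R p *m v + c *: ones) = dgmvp_map Sigma v)) /\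
  (* (iv) *)
  (forall c : R,
     dgmvp Sigma (c *: Sigma) = 0 /\
     (spd (Sigma + c *: Sigma) <-> -1 < c) /\
     (spd (Sigma + c *: Sigma) -> regret Sigma (Sigma + c *: Sigma) = 0)).
Proof.
move=> w; have w1 : dotv ones w = 1 by exact: dotv_ones_gmvp.
(* c Sigma w is a multiple of Sigma w, so scaling errors are a special case of the blind errors. *)
have wZ c : parallel ((c *: Sigma) *m w) ones.
  by apply/(parallel_ones_mulmx hp _ hSigma); exists c; rewrite scalemxAl.
split; [|split; [|split]].
- by move=> E1 E2 _ _ eqw; rewrite !dgmvpE -/w eqw.
- split; [|split; [|split]].
  + move=> E _; rewrite dgmvpE; split; first exact: dgmvp_map_eq0.
    exact: parallel_ones_mulmx.
  + by move=> v; apply: symmx_mulmx_surj.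
  + exists <[ones]>%VS; split; last exact: codimv_line_ones.
    move=> v; rewrite mem_line_ones; split=> [v1|[E [_ [-> //]]]].
    have [E [Es vE]] := symmx_mulmx_surj v w1.
    by exists E; rewrite -vE.
  + by move=> E _ Ew SEspd; rewrite regret_blind // /regret subrr.
- split; [|split].
  + by move=> E _; rewrite dgmvpE.
  (* The rank needs a bundled linear map, with the sign absorbed into its matrix. *)
  + pose f : 'Hom('cV[R]_p, 'cV[R]_p) :=
      linfun (mulmx (- ((1%:M - w *m ones^T) *m invmx Sigma))).
    have fE v : f v = dgmvp_map Sigma v by rewrite lfunE /= mulNmx.
    by exists f; split=> //; apply: dim_limg_dgmvp_map fE.
  (* P_1 v + c 1 differs from v by two multiples of 1, each in the kernel. *)
  + by move=> v c; rewrite P1_mulmx -scaleNr !dgmvp_map_addZones.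
- move=> c; split; first by rewrite dgmvpE; apply/dgmvp_map_eq0.
  by split; [exact: spd_addZ | move=> cspd; exact: regret_blind].
Qed.
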